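(* Let $n$ and $m$ be positive odd integers. Then \[ \int_{-1}^{1}\frac{\sin\bigl(n\sin^{-1}\sqrt t\bigr)\sinh\bigl(m\sinh^{-1}\sqrt t\bigr)}{\cos\bigl(2n\sin^{-1}\sqrt t\bigr)+\cosh\bigl(2m\sinh^{-1}\sqrt t\bigr)}\,\frac{t^j\,dt}{\sqrt{1-t^2}}=\begin{cases}\pi/2, & j=-1,\\ 0, & j=0,1,\ldots,\frac{m+n-2}{2},\end{cases} \] and \[ \int_{-1}^{1}\frac{\cos\bigl(n\sin^{-1}\sqrt t\bigr)\cosh\bigl(m\sinh^{-1}\sqrt t\bigr)}{\cos\bigl(2n\sin^{-1}\sqrt t\bigr)+\cosh\bigl(2m\sinh^{-1}\sqrt t\bigr)}\,t^j\,dt=0,\qquad j=0,1,\ldots,\tfrac{m+n-4}{2}. \]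
   Context: Convention for negative arguments: for $t\ge 0$, $\sqrt t$ is the nonnegative root; for $t<0$, $\sqrt t:=i\sqrt{-t}$, and one sets $\sin^{-1}(iy):=i\sinh^{-1}(y)$ for real $y\ge0$ and $\sinh^{-1}(iy):=i\sin^{-1}(y)$ for $0\le y\le 1$. With this convention the products appearing in the integrands are real-valued (they are values of polynomials in $t$, possibly times $\sqrt{1-t^2}$); in particular $\cos(2n\sin^{-1}\sqrt t)=T_n(1-2t)$ and $\cosh(2m\sinh^{-1}\sqrt t)=T_m(1+2t)$, where $T_k$ is the Chebyshev polynomial of the first kind, $T_k(\cos\theta)=\cos k\theta$. The denominator is positive on $[-1,1]$. *)

(* Defs.v *)
From Stdlib Require Import Reals.
From Coquelicot Require Import Coquelicot.
Open Scope R_scope.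

Definition asinh (x : R) : R := ln (x + sqrt (x ^ 2 + 1)).

(* The integrand pieces, with the paper's convention for t < 0:
   sqrt t = i sqrt(-t), asin(i y) = i asinh y, asinh(i y) = i asin y.
   Writing y = sqrt(-t), for t < 0:
   sin(n asin sqrt t) sinh(m asinh sqrt t) = (i sinh(n asinh y)) (i sin(m asin y))
   cos(2n asin sqrt t) = cosh(2n asinh y),  cosh(2m asinh sqrt t) = cos(2m asin y)
   cos(n asin sqrt t) cosh(m asinh sqrt t) = cosh(n asinh y) cos(m asin y). *)

Definition num1 (n m : nat) (t : R) : R :=
  if Rle_dec 0 t then
    sin (INR n * asin (sqrt t)) * sinh (INR m * asinh (sqrt t))
  else
    - (sinh (INR n * asinh (sqrt (- t))) * sin (INR m * asin (sqrt (- t)))).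

Definition num2 (n m : nat) (t : R) : R :=
  if Rle_dec 0 t then
    cos (INR n * asin (sqrt t)) * cosh (INR m * asinh (sqrt t))
  else
    cosh (INR n * asinh (sqrt (- t))) * cos (INR m * asin (sqrt (- t))).

Definition den (n m : nat) (t : R) : R :=
  if Rle_dec 0 t then
    cos (2 * INR n * asin (sqrt t)) + cosh (2 * INR m * asinh (sqrt t))
  else
    cosh (2 * INR n * asinh (sqrt (- t))) + cos (2 * INR m * asin (sqrt (- t))).

(* Main.v *)
Require Import Defs.
From Stdlib Require Import Reals Arith Lra Lia.
From Coquelicot Require Import Coquelicot.
Open Scope R_scope.

(** Write t = cos θ and z = exp (iθ) with 0 <= θ <= π, and n = 2k+1, m = 2l+1.
    Let a(z) be the part without s of (z - 1 + s)^n (1 + z - s)^m modulo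
    s^2 = 1 + z^2, a real polynomial in z. On the circle
    a(z) = 2 i z M(z) (num2(t) + i num1(t)), where M(z) = (-2z)^k (2z)^l, and
    den = 2 (num1^2 + num2^2), so that -z M(z)/a(z) = (num1 + i num2)/den.
    The polynomial a has no zero in the open unit disc: a zero would force
    (z - 1 + s)^n (1 + z - s)^m and (z - 1 - s)^n (1 + z + s)^m to have equal
    modulus, whereas for |z| < 1 the moduli of both factors change strictly in
    the same direction when s is replaced by -s. Each integral is thus the real
    part, integrated over the upper half circle, of a quotient of real
    polynomials which is analytic in the disc, and equals π times the value of
    the quotient at 0. The factors t and sin θ become (z + 1/z)/2 and
    (z - 1/z)/(2i), and the bounds on j say that z M(z) cancels the resulting
    pole at 0 and still leaves a zero there. For j = -1 one
    subtracts from the quotient a function that is purely imaginary on the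
    circle, in order to remove the poles at z = i and z = -i. *)

(** * Complex differentiation along curves *)

Definition curve_derive (g : R -> C) (x : R) (l : C) : Prop :=
  is_derive (fun t => Re (g t)) x (Re l) /\
  is_derive (fun t => Im (g t)) x (Im l).

Definition surface_continuous (g : R -> R -> C) (x y : R) : Prop :=
  continuity_2d_pt (fun s t => Re (g s t)) x y /\
  continuity_2d_pt (fun s t => Im (g s t)) x y.

(* Testing differentiability only on curves, and continuity only on
   two-parameter families, reduces the calculus rules to those of the real
   components and avoids the competing uniform structures on [C]. *)
Definition complex_derive (f : C -> C) (z d : C) : Prop :=
  forall g x l, g x = z -> curve_derive g x l ->
    curve_derive (fun t => f (g t)) x (d * l)%C.

Definition complex_continuous (f : C -> C) (z : C) : Prop :=
  forall g x y, g x y = z -> surface_continuous g x y ->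
    surface_continuous (fun s t => f (g s t)) x y.

(** Continuity of the derivative is included because differentiation under the integral sign and the
    fundamental theorem of calculus both ask for it. *)
Definition holomorphic_at (f f' : C -> C) (z : C) : Prop :=
  complex_derive f z (f' z) /\ complex_continuous f z /\
  complex_continuous f' z.

Lemma is_derive_eq (f : R -> R) (x l l' : R) :
  is_derive f x l -> l = l' -> is_derive f x l'.
Proof. now intros H <-. Qed.

Lemma complex_continuous_const (c z : C) :
  complex_continuous (fun _ => c) z.
Proof. intros g x y _ _; split; apply continuity_2d_pt_const. Qed.

Lemma complex_continuous_plus (f h : C -> C) (z : C) :
  complex_continuous f z -> complex_continuous h z ->
  complex_continuous (fun w => f w + h w)%C z.
Proof.
intros Hf Hh g x y E Hg.
destruct (Hf g x y E Hg) as [F1 F2], (Hh g x y E Hg) as [G1 G2].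
split; [exact (continuity_2d_pt_plus _ _ _ _ F1 G1)
       |exact (continuity_2d_pt_plus _ _ _ _ F2 G2)].
Qed.

Lemma complex_continuous_mult (f h : C -> C) (z : C) :
  complex_continuous f z -> complex_continuous h z ->
  complex_continuous (fun w => f w * h w)%C z.
Proof.
intros Hf Hh g x y E Hg.
destruct (Hf g x y E Hg) as [F1 F2], (Hh g x y E Hg) as [G1 G2].
split.
- exact (continuity_2d_pt_minus _ _ _ _
    (continuity_2d_pt_mult _ _ _ _ F1 G1)
    (continuity_2d_pt_mult _ _ _ _ F2 G2)).
- exact (continuity_2d_pt_plus _ _ _ _
    (continuity_2d_pt_mult _ _ _ _ F1 G2)
    (continuity_2d_pt_mult _ _ _ _ F2 G1)).
Qed.

Lemma sqr_norm_neq_0 (z : C) : z <> 0 -> (fst z ^ 2 + snd z ^ 2)%R <> 0%R.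
Proof.
intros Hz H; apply Hz.
destruct z as [a b]; simpl in H; apply injective_projections; simpl; nra.
Qed.

Lemma complex_continuous_inv (f : C -> C) (z : C) :
  f z <> 0 -> complex_continuous f z ->
  complex_continuous (fun w => / f w)%C z.
Proof.
intros Hz Hf g x y E Hg.
destruct (Hf g x y E Hg) as [F1 F2].
assert (N : continuity_2d_pt
    (fun s t => / (fst (f (g s t)) ^ 2 + snd (f (g s t)) ^ 2)) x y).
{ apply continuity_2d_pt_inv.
  - apply (continuity_2d_pt_ext (fun s t =>
      fst (f (g s t)) * fst (f (g s t)) + snd (f (g s t)) * snd (f (g s t)))).
    + intros; ring.
    + apply continuity_2d_pt_plus; now apply continuity_2d_pt_mult.
  - rewrite E; now apply sqr_norm_neq_0. }
split; apply (continuity_2d_pt_mult _ _ _ _).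
- exact F1.
- exact N.
- exact (continuity_2d_pt_opp _ _ _ F2).
- exact N.
Qed.

Lemma complex_derive_inv (f : C -> C) (z d : C) :
  f z <> 0 -> complex_derive f z d ->
  complex_derive (fun w => / f w)%C z (- (d / (f z * f z)))%C.
Proof.
intros Hz Hf g x l E Hg.
destruct (Hf g x l E Hg) as [F1 F2].
assert (N : fst (f (g x)) ^ 2 + snd (f (g x)) ^ 2 <> 0)
  by (rewrite E; now apply sqr_norm_neq_0).
assert (N' : is_derive (fun t => fst (f (g t)) ^ 2 + snd (f (g t)) ^ 2) x
   (2 * (fst (f z) * Re (d * l)%C + snd (f z) * Im (d * l)%C))).
{ eapply is_derive_eq.
  - exact (is_derive_plus _ _ _ _ _ (is_derive_pow _ 2 _ _ F1)
                                    (is_derive_pow _ 2 _ _ F2)).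
  - unfold plus, Re, Im; simpl; rewrite E; ring. }
rewrite E in N.
(* The denominators met by [field] are [|w^2|^2] and [|w|^2] for [w = a + ib]; the first is the
   square of the second. *)
assert (S : forall a b : R, a ^ 2 + b ^ 2 <> 0 ->
  (a * a - b * b) * (a * a - b * b) + (a * b + b * a) * (a * b + b * a) <> 0
  /\ a * a + b * b <> 0).
{ intros a b K.
  assert (K' : a * a + b * b <> 0) by (intros K'; apply K; rewrite <- K'; ring).
  split; [|exact K'].
  replace (_ + _) with ((a * a + b * b) * (a * a + b * b)) by ring.
  now apply Rmult_integral_contrapositive. }
specialize (S _ _ N).
split.
- eapply is_derive_eq.
  + apply (is_derive_div _ _ _ _ _ F1 N'); now rewrite E.
  + rewrite E; unfold Re, Im; destruct (f z) as [a b], d, l; simpl in *.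
    field; exact S.
- eapply is_derive_eq.
  + apply (is_derive_div _ _ _ _ _ (is_derive_opp _ _ _ F2) N'); now rewrite E.
  + rewrite E; unfold Re, Im, opp; destruct (f z) as [a b], d, l; simpl in *.
    field; exact S.
Qed.

Lemma complex_derive_plus (f h : C -> C) (z d e : C) :
  complex_derive f z d -> complex_derive h z e ->
  complex_derive (fun w => f w + h w)%C z (d + e)%C.
Proof.
intros Hf Hh g x l E Hg.
destruct (Hf g x l E Hg) as [F1 F2], (Hh g x l E Hg) as [G1 G2].
split; eapply is_derive_eq.
- exact (is_derive_plus _ _ _ _ _ F1 G1).
- unfold plus; simpl; ring.
- exact (is_derive_plus _ _ _ _ _ F2 G2).
- unfold plus; simpl; ring.
Qed.

Lemma complex_derive_mult (f h : C -> C) (z d e : C) :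
  complex_derive f z d -> complex_derive h z e ->
  complex_derive (fun w => f w * h w)%C z (d * h z + f z * e)%C.
Proof.
intros Hf Hh g x l E Hg.
destruct (Hf g x l E Hg) as [F1 F2], (Hh g x l E Hg) as [G1 G2].
split; eapply is_derive_eq.
- exact (is_derive_minus _ _ _ _ _ (Derive.is_derive_mult _ _ _ _ _ F1 G1)
                                   (Derive.is_derive_mult _ _ _ _ _ F2 G2)).
- unfold minus, plus, opp; simpl; rewrite E; unfold Re, Im; ring.
- exact (is_derive_plus _ _ _ _ _ (Derive.is_derive_mult _ _ _ _ _ F1 G2)
                                  (Derive.is_derive_mult _ _ _ _ _ F2 G1)).
- unfold plus; simpl; rewrite E; unfold Re, Im; ring.
Qed.

Lemma holomorphic_const (c z : C) :
  holomorphic_at (fun _ => c) (fun _ => RtoC 0) z.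
Proof.
split; [|split; apply complex_continuous_const].
intros g x l _ _; split; eapply is_derive_eq.
- exact (is_derive_const (Re c) x).
- unfold zero; simpl; ring.
- exact (is_derive_const (Im c) x).
- unfold zero; simpl; ring.
Qed.

Lemma holomorphic_id (z : C) : holomorphic_at (fun w => w) (fun _ => RtoC 1) z.
Proof.
split; [|split].
- intros g x l _ Hg; now rewrite Cmult_1_l.
- now intros g x y _ Hg.
- apply complex_continuous_const.
Qed.

Lemma holomorphic_plus (f f' h h' : C -> C) (z : C) :
  holomorphic_at f f' z -> holomorphic_at h h' z ->
  holomorphic_at (fun w => f w + h w)%C (fun w => f' w + h' w)%C z.
Proof.
intros [F1 [F2 F3]] [H1 [H2 H3]]; split; [|split].
- now apply complex_derive_plus.
- now apply complex_continuous_plus.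
- now apply complex_continuous_plus.
Qed.

Lemma holomorphic_mult (f f' h h' : C -> C) (z : C) :
  holomorphic_at f f' z -> holomorphic_at h h' z ->
  holomorphic_at (fun w => f w * h w)%C (fun w => f' w * h w + f w * h' w)%C z.
Proof.
intros [F1 [F2 F3]] [H1 [H2 H3]]; split; [|split].
- now apply complex_derive_mult.
- now apply complex_continuous_mult.
- apply complex_continuous_plus; now apply complex_continuous_mult.
Qed.

(** The derivative is written with products and an inverse only, so that its continuity follows from
    the rules above. *)
Lemma holomorphic_inv (f f' : C -> C) (z : C) :
  f z <> 0 -> holomorphic_at f f' z ->
  holomorphic_at (fun w => / f w)%C
    (fun w => RtoC (-1) * (f' w * / (f w * f w)))%C z.
Proof.
intros Hz [F1 [F2 F3]]; split; [|split].
- replace (RtoC (-1) * _)%C with (- (f' z / (f z * f z)))%C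
    by (unfold Cdiv; ring).
  now apply complex_derive_inv.
- now apply complex_continuous_inv.
- apply complex_continuous_mult; [apply complex_continuous_const|].
  apply complex_continuous_mult; [assumption|].
  apply (complex_continuous_inv (fun w => f w * f w)%C);
    [now apply Cmult_neq_0|now apply complex_continuous_mult].
Qed.

(** Reality on the real line is what makes boundary terms vanish at the two ends of a half
    circle. *)
Definition real_entire (f : C -> C) : Prop :=
  (exists f', forall z, holomorphic_at f f' z) /\
  (forall x : R, Im (f (RtoC x)) = 0).

Lemma real_entire_const (a : R) : real_entire (fun _ => RtoC a).
Proof.
split; [eexists; intros z; apply holomorphic_const|reflexivity].
Qed.

Lemma real_entire_id : real_entire (fun z => z).
Proof.
split; [eexists; intros z; apply holomorphic_id|reflexivity].
Qed.

Lemma real_entire_plus (f h : C -> C) :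
  real_entire f -> real_entire h -> real_entire (fun z => f z + h z)%C.
Proof.
intros [[f' Hf] Rf] [[h' Hh] Rh]; split.
- eexists; intros z; now apply holomorphic_plus.
- intros x; simpl; unfold Im in *; rewrite Rf, Rh; ring.
Qed.

Lemma real_entire_mult (f h : C -> C) :
  real_entire f -> real_entire h -> real_entire (fun z => f z * h z)%C.
Proof.
intros [[f' Hf] Rf] [[h' Hh] Rh]; split.
- eexists; intros z; now apply holomorphic_mult.
- intros x; simpl; unfold Im in *; rewrite Rf, Rh; ring.
Qed.

Lemma real_entire_pow (f : C -> C) (n : nat) :
  real_entire f -> real_entire (fun z => f z ^ n)%C.
Proof.
intros Hf; induction n as [|n IH]; simpl.
- apply real_entire_const.
- now apply real_entire_mult.
Qed.

(** * The mean value property on a half circle *)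

(** Uniform continuity along the compact segment bounds the difference of the integrands by [eps].
    Integrability at [c] follows from continuity; at [y] it is assumed, since continuity is given
    only at points with second coordinate [c]. *)
Lemma RInt_param_close (f : R -> R -> R) (a b c : R) :
  a <= b ->
  (forall x, a <= x <= b -> continuity_2d_pt f x c) ->
  forall eps : posreal, exists delta : posreal, forall y,
    Rabs (y - c) < delta -> ex_RInt (fun x => f x y) a b ->
    Rabs (RInt (fun x => f x y) a b - RInt (fun x => f x c) a b)
      <= (b - a) * eps.
Proof.
intros Hab Hf eps.
destruct (uniform_continuity_2d_1d f a b c Hf eps) as [delta Hd].
exists delta; intros y Hy Ey.
assert (Ec : ex_RInt (fun x => f x c) a b).
{ apply (ex_RInt_continuous (V := R_CompleteNormedModule)); intros x Hx.
  rewrite Rmin_left, Rmax_right in Hx by assumption.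
  apply continuity_pt_filterlim.
  intros e He; destruct (Hf x Hx (mkposreal e He)) as [d H].
  exists d; split; [apply cond_pos|]; intros u [_ Hu].
  apply H; [exact Hu|].
  rewrite Rminus_eq_0, Rabs_R0; apply cond_pos. }
rewrite <- (RInt_minus _ _ _ _ Ey Ec : _ = RInt _ a b - RInt _ a b).
apply abs_RInt_le_const; [assumption| |].
- now apply (ex_RInt_minus (V := R_NormedModule)).
- intros t Ht; left.
  apply Rabs_def2 in Hy; assert (D := cond_pos delta).
  apply (Hd t c t y); try assumption; try (split; lra).
  rewrite Rminus_eq_0, Rabs_R0; exact D.
Qed.

(** * Polar coordinates and integrals over half circles *)

Definition polar (r theta : R) : C := (r * cos theta, r * sin theta).

Lemma Cmod_polar (r theta : R) : Cmod (polar r theta) = Rabs r.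
Proof.
unfold Cmod, polar; simpl.
rewrite <- sqrt_Rsqr_abs; f_equal; unfold Rsqr.
generalize (sin2_cos2 theta); unfold Rsqr; intros H.
replace (_ + _) with (r * r * (sin theta * sin theta + cos theta * cos theta))
  by ring.
rewrite H; ring.
Qed.

Lemma curve_derive_polar_radius (r theta : R) :
  curve_derive (fun u => polar u theta) r (polar 1 theta).
Proof. split; simpl; auto_derive; trivial. Qed.

Lemma curve_derive_polar_angle (r theta : R) :
  curve_derive (polar r) theta (Ci * polar r theta)%C.
Proof. split; simpl; auto_derive; trivial; ring. Qed.

Lemma surface_continuous_polar (r theta : R) :
  surface_continuous polar r theta.
Proof.
split; simpl; apply continuity_2d_pt_mult; try apply continuity_2d_pt_id1.
- apply (continuity_1d_2d_pt_comp cos); [apply continuity_cos|].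
  apply continuity_2d_pt_id2.
- apply (continuity_1d_2d_pt_comp sin); [apply continuity_sin|].
  apply continuity_2d_pt_id2.
Qed.

Lemma surface_continuous_polar_swap (r theta : R) :
  surface_continuous (fun t u => polar u t) theta r.
Proof.
split; simpl; apply continuity_2d_pt_mult; try apply continuity_2d_pt_id2.
- apply (continuity_1d_2d_pt_comp cos); [apply continuity_cos|].
  apply continuity_2d_pt_id1.
- apply (continuity_1d_2d_pt_comp sin); [apply continuity_sin|].
  apply continuity_2d_pt_id1.
Qed.

Lemma continuity_2d_pt_angle (f : R -> R -> R) (r theta : R) :
  continuity_2d_pt f r theta -> continuous (f r) theta.
Proof.
intros Hf; apply continuity_pt_filterlim.
intros e He; destruct (Hf (mkposreal e He)) as [d H].
exists d; split; [apply cond_pos|]; intros u [_ Hu].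
apply H; [|exact Hu].
rewrite Rminus_eq_0, Rabs_R0; apply cond_pos.
Qed.

Definition half_circle_integral (f : C -> C) (r : R) : R :=
  RInt (fun theta => Re (f (polar r theta))) 0 PI.

Lemma half_circle_ex_RInt (f f' : C -> C) (r : R) :
  (forall z, Cmod z < 1 -> holomorphic_at f f' z) ->
  Rabs r < 1 -> ex_RInt (fun theta => Re (f (polar r theta))) 0 PI.
Proof.
intros holo Hr; apply (ex_RInt_continuous (V := R_CompleteNormedModule)).
intros t _; apply (continuity_2d_pt_angle (fun r t => Re (f (polar r t)))).
destruct (holo (polar r t)) as [_ [H _]]; [now rewrite Cmod_polar|].
apply (H polar r t eq_refl), surface_continuous_polar.
Qed.

(** Differentiating under the integral sign leaves [1/r] times the change of [Im f] along the half
    circle, and [f] is real at both ends [r] and [-r]. *)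
Lemma half_circle_is_derive (f f' : C -> C) (r : R) :
  (forall z, Cmod z < 1 -> holomorphic_at f f' z) ->
  (forall x : R, Im (f (RtoC x)) = 0) ->
  0 < r < 1 -> is_derive (half_circle_integral f) r 0.
Proof.
intros holo real Hr.
assert (near : locally r (fun u => 0 < u < 1)).
{ apply filter_and; [now apply (open_gt 0)|now apply (open_lt 1)]. }
assert (small : forall u, 0 < u < 1 -> Rabs u < 1)
  by (intros u Hu; rewrite Rabs_pos_eq; lra).
assert (D : forall u t, 0 < u < 1 ->
  is_derive (fun s => Re (f (polar s t))) u
    (Re (f' (polar u t) * polar 1 t)%C)).
{ intros u t Hu.
  destruct (holo (polar u t)) as [H _]; [rewrite Cmod_polar; now apply small|].
  apply (H (fun s => polar s t) u _ eq_refl), curve_derive_polar_radius. }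
assert (C2 : forall t, surface_continuous
  (fun u v => f' (polar u v) * polar 1 v)%C r t).
{ intros t.
  destruct (holo (polar r t)) as [_ [_ H]];
    [rewrite Cmod_polar; now apply small|].
  destruct (H polar r t eq_refl (surface_continuous_polar r t)) as [A1 A2].
  assert (B : surface_continuous (fun _ v => polar 1 v) r t).
  { split; simpl; apply continuity_2d_pt_mult;
      try apply continuity_2d_pt_const.
    - apply (continuity_1d_2d_pt_comp cos); [apply continuity_cos|].
      apply continuity_2d_pt_id2.
    - apply (continuity_1d_2d_pt_comp sin); [apply continuity_sin|].
      apply continuity_2d_pt_id2. }
  destruct B as [B1 B2]; split.
  - exact (continuity_2d_pt_minus _ _ _ _
      (continuity_2d_pt_mult _ _ _ _ A1 B1)
      (continuity_2d_pt_mult _ _ _ _ A2 B2)).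
  - exact (continuity_2d_pt_plus _ _ _ _
      (continuity_2d_pt_mult _ _ _ _ A1 B2)
      (continuity_2d_pt_mult _ _ _ _ A2 B1)). }
eapply is_derive_eq.
- unfold half_circle_integral.
  apply (is_derive_RInt_param (fun r t => Re (f (polar r t))) 0 PI r).
  + revert near; apply filter_imp; intros u Hu t _.
    eexists; now apply D.
  + intros t _.
    apply (continuity_2d_pt_ext_loc
      (fun u v => Re (f' (polar u v) * polar 1 v)%C)).
    * destruct near as [d Hd]; exists d; intros u v Hu _.
      symmetry; apply is_derive_unique, D, Hd, Hu.
    * apply C2.
  + revert near; apply filter_imp; intros u Hu.
    apply (half_circle_ex_RInt f f' _ holo); now apply small.
- (* By the Cauchy-Riemann equations [r] times the integrand is the
     angular derivative of [Im f]. *)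
  rewrite (RInt_ext _ (fun t => Re (f' (polar r t) * polar 1 t)%C))
    by (intros t _; now apply is_derive_unique, D).
  assert (I : is_RInt (fun t => r * Re (f' (polar r t) * polar 1 t)%C) 0 PI
     (minus (Im (f (polar r PI))) (Im (f (polar r 0))))).
  { apply (is_RInt_derive (fun t => Im (f (polar r t)))).
    - intros t _.
      destruct (holo (polar r t)) as [H _];
        [rewrite Cmod_polar; now apply small|].
      eapply is_derive_eq.
      + exact (proj2 (H (polar r) t _ eq_refl (curve_derive_polar_angle r t))).
      + simpl; ring.
    - intros t _.
      apply (continuous_scal_r (V := R_NormedModule) r).
      apply (continuity_2d_pt_angle
        (fun u v => Re (f' (polar u v) * polar 1 v)%C)), C2. }
  assert (E : ex_RInt (fun t => Re (f' (polar r t) * polar 1 t)%C) 0 PI).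
  { apply (ex_RInt_continuous (V := R_CompleteNormedModule)); intros t _.
    apply (continuity_2d_pt_angle
      (fun u v => Re (f' (polar u v) * polar 1 v)%C)), C2. }
  assert (Z0 : polar r PI = RtoC (- r))
    by (unfold polar, RtoC; rewrite cos_PI, sin_PI; f_equal; ring).
  assert (Z1 : polar r 0 = RtoC r)
    by (unfold polar, RtoC; rewrite cos_0, sin_0; f_equal; ring).
  rewrite Z0, Z1, !real in I.
  apply (is_RInt_unique (V := R_CompleteNormedModule)) in I.
  rewrite (RInt_scal (V := R_CompleteNormedModule)) in I by exact E.
  unfold scal, minus, plus, opp in I; simpl in I; unfold mult in I; simpl in I.
  destruct (Rmult_integral _ _ (eq_trans I (Rplus_opp_r 0))) as [K|K]; [lra|]. exact K.
Qed.

(* It suffices to integrate over the upper half circle because [f] is real at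
   both of its end points. *)
Lemma half_mean_value (f f' : C -> C) :
  (forall z, Cmod z < 1 -> holomorphic_at f f' z) ->
  (forall theta, 0 <= theta <= PI -> complex_continuous f (polar 1 theta)) ->
  (forall x : R, Im (f (RtoC x)) = 0) ->
  RInt (fun theta => Re (f (polar 1 theta))) 0 PI = PI * Re (f 0).
Proof.
intros holo cont real.
set (F := half_circle_integral f).
assert (P := PI_RGT_0).
assert (F0 : F 0 = PI * Re (f 0)).
{ unfold F, half_circle_integral; rewrite (RInt_ext _ (fun _ => Re (f 0))).
  - rewrite RInt_const; unfold scal; simpl; unfold mult; simpl; ring.
  - intros t _; do 2 f_equal.
    unfold polar, RtoC; f_equal; ring. }
(* Continuity of the integral in the radius. At [c = 1] only radii of modulus below 1 are compared,
   and continuity of [f] on the closed arc suffices. *)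
assert (close : forall c, Rabs c < 1 \/ c = 1 ->
  forall eps : posreal, exists delta : posreal, forall y,
    Rabs (y - c) < delta -> Rabs y < 1 ->
    Rabs (F y - F c) <= PI * eps).
{ intros c Hc eps.
  destruct (RInt_param_close (fun t r => Re (f (polar r t))) 0 PI c) with eps
    as [delta Hd]; [lra| |].
  - intros t Ht.
    apply (fun H : complex_continuous f (polar c t) =>
      H (fun t r => polar r t) t c eq_refl (surface_continuous_polar_swap c t)).
    destruct Hc as [Hc| ->]; [|now apply cont].
    apply holo; now rewrite Cmod_polar.
  - exists delta; intros y Hy Hy1.
    replace (PI * eps) with ((PI - 0) * eps) by ring.
    apply Hd; [exact Hy|now apply (half_circle_ex_RInt f f')]. }
(* The mean value theorem with derivative zero on [(0, r)]; [close] supplies the continuity, in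
   particular at radius 0. *)
assert (inner : forall r, 0 <= r < 1 -> F r = F 0).
{ intros r Hr.
  destruct (MVT_gen F 0 r (fun _ => 0)) as [c [_ H]].
  - intros x Hx; rewrite Rmin_left, Rmax_right in Hx by lra.
    apply (half_circle_is_derive f f' _ holo real); lra.
  - intros x Hx; rewrite Rmin_left, Rmax_right in Hx by lra.
    intros e He.
    destruct (close x) with (mkposreal (e / (2 * PI))
      (Rdiv_lt_0_compat _ _ He (Rmult_lt_0_compat 2 PI Rlt_0_2 P)))
      as [d Hd]; [left; rewrite Rabs_pos_eq; lra|].
    exists (Rmin d (1 - x)); split.
    + apply Rmin_pos; [apply cond_pos|lra].
    + intros y [_ Hy]; simpl in Hy; unfold Rdist in Hy.
      assert (Hy1 := Rlt_le_trans _ _ _ Hy (Rmin_l _ _)).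
      assert (Hy2 := Rlt_le_trans _ _ _ Hy (Rmin_r _ _)).
      apply Rle_lt_trans with (PI * (e / (2 * PI))).
      * apply Hd; [exact Hy1|].
        apply Rabs_def2 in Hy2; apply Rabs_def1; lra.
      * replace (PI * (e / (2 * PI))) with (e / 2) by (field; lra); lra.
  - lra. }
change (F 1 = PI * Re (f 0)); rewrite <- F0.
apply Rminus_diag_uniq, Rabs_eq_0, Rle_antisym; [|apply Rabs_pos].
apply le_epsilon; intros e He; rewrite Rplus_0_l.
destruct (close 1 (or_intror eq_refl))
  with (mkposreal (e / PI) (Rdiv_lt_0_compat _ _ He P)) as [d Hd].
(* A radius in [[1/2, 1)] at distance less than [d] from 1. *)
set (y := 1 - Rmin (d / 2) (1 / 2)).
assert (Y : 0 < Rmin (d / 2) (1 / 2) <= 1 / 2 /\ Rmin (d / 2) (1 / 2) < d).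
{ assert (D := cond_pos d); split; [split|].
  - apply Rmin_pos; lra.
  - apply Rmin_r.
  - apply Rle_lt_trans with (d / 2); [apply Rmin_l|lra]. }
rewrite Rabs_minus_sym, <- (inner y) by (unfold y; lra).
replace e with (PI * (e / PI)) by (field; lra).
apply Hd; unfold y; [apply Rabs_def1|apply Rabs_def1]; lra.
Qed.

(** * The polynomial a *)

(** For [z = a + ib] of modulus [m], a root is [√((m + a)/2) ± i √((m - a)/2)], with the sign of
    [b]. *)
Lemma C_sqrt_exists (z : C) : exists s : C, (s * s)%C = z.
Proof.
destruct z as [a b].
set (m := sqrt (a ^ 2 + b ^ 2)).
assert (Hm : m * m = a ^ 2 + b ^ 2) by (apply sqrt_sqrt; nra).
assert (m0 : 0 <= m) by apply sqrt_pos.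
assert (Ha : Rabs a <= m).
{ apply Rsqr_incr_0_var; [|exact m0].
  rewrite <- Rsqr_abs; unfold Rsqr; nra. }
apply Rabs_le_between in Ha.
set (x := sqrt ((m + a) / 2)); set (y := sqrt ((m - a) / 2)).
assert (Hx : x * x = (m + a) / 2) by (apply sqrt_sqrt; lra).
assert (Hy : y * y = (m - a) / 2) by (apply sqrt_sqrt; lra).
assert (Hxy : 2 * (x * y) = Rabs b).
{ unfold x, y; rewrite <- sqrt_mult by lra.
  replace ((m + a) / 2 * ((m - a) / 2)) with (Rsqr (b / 2))
    by (unfold Rsqr; nra).
  rewrite sqrt_Rsqr_abs; unfold Rdiv; rewrite Rabs_mult, (Rabs_pos_eq (/ 2)); lra. }
destruct (Rle_dec 0 b) as [Hb|Hb].
- rewrite Rabs_pos_eq in Hxy by lra.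
  exists (x, y); apply injective_projections; simpl; lra.
- rewrite Rabs_left in Hxy by lra.
  exists (x, - y); apply injective_projections; simpl; lra.
Qed.

(** This is [M]. If [w^2 = 2z], then [(i w)^(2k+1) w^(2l+1) = 2 i z M(z)], which is how it arises on
    the circle. *)
Definition monomial_part (k l : nat) (z : C) : C :=
  ((-2 * z) ^ k * (2 * z) ^ l)%C.

Ltac real_entire :=
  lazymatch goal with
  | |- real_entire (fun z => Cplus (@?f z) (@?g z)) =>
      apply (real_entire_plus f g); real_entire
  | |- real_entire (fun z => Cmult (@?f z) (@?g z)) =>
      apply (real_entire_mult f g); real_entire
  | |- real_entire (fun z => Cpow (@?f z) ?n) =>
      apply (real_entire_pow f n); real_entire
  | |- real_entire (fun _ => RtoC ?a) => exact (real_entire_const a)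
  | |- real_entire (fun z => z) => exact real_entire_id
  | |- real_entire ?f => assumption
  end.

Lemma real_entire_monomial_part (k l : nat) : real_entire (monomial_part k l).
Proof. unfold monomial_part; real_entire. Qed.

(** Multiplication by [(z - 1 + s)^2 = 2 (1 + z^2) - 2z + 2 (z - 1) s] or [(1 + z - s)^2 = 2 (1 +
    z^2) + 2z - 2 (1 + z) s] keeps the form [a + b s], and modulo [1 + z^2] it multiplies [a] by
    [-2z] or [2z]. The resulting congruence, with quotient [q], serves to remove the poles at [i]
    and [-i] for the exponent -1. *)
Lemma rational_part_exists (k l : nat) : exists a b q : C -> C,
  real_entire a /\ real_entire b /\ real_entire q /\
  (forall z s : C, (s * s = 1 + z * z ->
    (z - 1 + s) ^ (2 * k + 1) * (1 + z - s) ^ (2 * l + 1) = a z + b z * s)%C) /\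
  (forall z : C,
    a z = monomial_part k l z * (z * z - 1) + (1 + z * z) * q z)%C.
Proof.
revert k; induction l as [|l IHl]; intros k; [induction k as [|k IHk]|].
(* For [k = l = 0] the product is [z^2 - 1 - s^2 + 2s = -2 + 2s], and
   [-2 = (z^2 - 1) - (1 + z^2)]. *)
- exists (fun _ => RtoC (-2)), (fun _ => RtoC 2), (fun _ => RtoC (-1)).
  split; [real_entire|split; [real_entire|split; [real_entire|split]]].
  + intros z s H; simpl.
    replace ((z - 1 + s) * 1 * ((1 + z - s) * 1))%C
      with (z * z - 1 - s * s + 2 * s)%C by ring.
    rewrite H; ring.
  + intros z; unfold monomial_part; simpl; ring.
- destruct IHk as [a [b [q [Ha [Hb [Hq [E Q]]]]]]].
  exists (fun z => a z * (2 * (1 + z * z) + -2 * z)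
                   + 2 * (b z * ((z + -1) * (1 + z * z))))%C.
  exists (fun z => 2 * (a z * (z + -1))
                   + b z * (2 * (1 + z * z) + -2 * z))%C.
  exists (fun z => -2 * (z * q z) + 2 * (a z + b z * (z + -1)))%C.
  split; [real_entire|split; [real_entire|split; [real_entire|split]]].
  + intros z s H.
    replace (2 * S k + 1)%nat with (2 + (2 * k + 1))%nat by lia.
    rewrite (Cpow_add_r _ 2), <- Cmult_assoc, E by exact H.
    replace ((z - 1 + s) ^ 2)%C with
      ((z - 1) * (z - 1) + s * s + 2 * (z - 1) * s)%C by ring.
    rewrite H.
    transitivity
      (a z * ((z - 1) * (z - 1) + (1 + z * z)) + 2 * b z * (z - 1) * (s * s)
       + (2 * a z * (z - 1) + b z * ((z - 1) * (z - 1) + (1 + z * z))) * s)%C;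
      [ring|rewrite H; ring].
  + intros z.
    transitivity (-2 * z * a z + (1 + z * z) * (2 * (a z + b z * (z + -1))))%C;
      [ring|].
    rewrite Q at 1; unfold monomial_part; rewrite Cpow_S; ring.
- destruct (IHl k) as [a [b [q [Ha [Hb [Hq [E Q]]]]]]].
  exists (fun z => a z * (2 * (1 + z * z) + 2 * z)
                   + -2 * (b z * ((1 + z) * (1 + z * z))))%C.
  exists (fun z => -2 * (a z * (1 + z))
                   + b z * (2 * (1 + z * z) + 2 * z))%C.
  exists (fun z => 2 * (z * q z) + 2 * (a z + -1 * (b z * (1 + z))))%C.
  split; [real_entire|split; [real_entire|split; [real_entire|split]]].
  + intros z s H.
    replace (2 * S l + 1)%nat with (2 + (2 * l + 1))%nat by lia.
    rewrite (Cpow_add_r _ 2), (Cmult_comm ((1 + z - s) ^ 2)%C), Cmult_assoc, E by exact H.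
    replace ((1 + z - s) ^ 2)%C with
      ((1 + z) * (1 + z) + s * s - 2 * (1 + z) * s)%C by ring.
    rewrite H.
    transitivity
      (a z * ((1 + z) * (1 + z) + (1 + z * z)) - 2 * b z * (1 + z) * (s * s)
       + (-2 * a z * (1 + z) + b z * ((1 + z) * (1 + z) + (1 + z * z))) * s)%C;
      [ring|rewrite H; ring].
  + intros z.
    transitivity (2 * z * a z + (1 + z * z) * (2 * (a z + -1 * (b z * (1 + z)))))%C;
      [ring|].
    rewrite Q at 1; unfold monomial_part; rewrite (Cpow_S _ l); ring.
Qed.

(** Summing over the two roots [s] and [-s] eliminates [b]. In this form [a] is studied both inside
    the disc and on the circle. *)
Definition is_rational_part (k l : nat) (a : C -> C) : Prop :=
  forall z s : C, (s * s = 1 + z * z ->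
    2 * a z = (z - 1 + s) ^ (2 * k + 1) * (1 + z - s) ^ (2 * l + 1)
      + (z - 1 - s) ^ (2 * k + 1) * (1 + z + s) ^ (2 * l + 1))%C.

Lemma rational_part_conjugate_sum (k l : nat) (a b : C -> C) :
  (forall z s : C, (s * s = 1 + z * z ->
    (z - 1 + s) ^ (2 * k + 1) * (1 + z - s) ^ (2 * l + 1) = a z + b z * s)%C) ->
  is_rational_part k l a.
Proof.
intros E z s H.
assert (H' : ((- s) * (- s) = 1 + z * z)%C) by (rewrite <- H; ring).
assert (E1 := E z s H); assert (E2 := E z (- s)%C H').
replace (z - 1 + - s)%C with (z - 1 - s)%C in E2 by ring.
replace (1 + z - - s)%C with (1 + z + s)%C in E2 by ring.
rewrite E1, E2; ring.
Qed.

Lemma Cmod_sqr (z : C) : Cmod z ^ 2 = fst z ^ 2 + snd z ^ 2.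
Proof. exact (Cmod2_alt z). Qed.

(* The product equals [8 ((1 - |z|^2) |s|^2 + 1 - |z|^4)]. *)
Lemma conjugate_factors_same_side (z s : C) :
  Cmod z < 1 -> (s * s = 1 + z * z)%C ->
  0 < (Cmod (z - 1 + s) ^ 2 - Cmod (z - 1 - s) ^ 2)
      * (Cmod (1 + z - s) ^ 2 - Cmod (1 + z + s) ^ 2).
Proof.
intros Hz H.
assert (Hz2 : fst z ^ 2 + snd z ^ 2 < 1)
  by (rewrite <- Cmod_sqr; assert (M := Cmod_ge_0 z); nra).
destruct z as [x y], s as [c d].
assert (H1 := f_equal fst H); assert (H2 := f_equal snd H).
simpl in H1, H2, Hz2; rewrite !Cmod_sqr; simpl.
set (r := x * (x * 1) + y * (y * 1)) in *.
apply Rlt_le_trans with (8 * ((c * c + d * d) * (1 - r) + (1 - r * r))).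
- assert (0 <= r) by (unfold r; nra).
  assert (0 <= c * c + d * d) by nra.
  nra.
- right; unfold r.
  assert (CD : c * d = x * y) by lra.
  assert (DD : d * d = c * c - (1 + (x * x - y * y))) by lra.
  transitivity
    (16 * (c * c - x * x * (c * c) - y * y * (d * d) - 2 * (x * y) * (c * d)));
    [rewrite CD, DD|]; ring.
Qed.

Lemma pow_mult_lt (a a' b b' : R) (n m : nat) :
  0 <= a < a' -> 0 <= b < b' -> (0 < n)%nat -> a ^ n * b ^ m < a' ^ n * b' ^ m.
Proof.
intros Ha Hb Hn.
apply Rle_lt_trans with (a ^ n * b' ^ m).
- apply Rmult_le_compat_l; [now apply pow_le|apply pow_incr; lra].
- apply Rmult_lt_compat_r; [apply pow_lt; lra|].
  destruct n as [|n]; [lia|clear Hn].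
  induction n as [|n IH]; [simpl; lra|].
  rewrite <- 2!(tech_pow_Rmult _ (S n)).
  apply Rmult_le_0_lt_compat; try lra; apply pow_le; lra.
Qed.

Lemma rational_part_neq_0 (k l : nat) (a : C -> C) (z : C) :
  is_rational_part k l a -> Cmod z < 1 -> a z <> 0.
Proof.
intros Ha Hz Z.
destruct (C_sqrt_exists (1 + z * z)%C) as [s Hs].
assert (S := conjugate_factors_same_side z s Hz Hs).
assert (E := Ha z s Hs); rewrite Z in E.
assert (M : Cmod (z - 1 + s) ^ (2 * k + 1) * Cmod (1 + z - s) ^ (2 * l + 1)
  = Cmod (z - 1 - s) ^ (2 * k + 1) * Cmod (1 + z + s) ^ (2 * l + 1)).
{ rewrite <- !Cmod_pow, <- !Cmod_mult.
  rewrite <- (Cmod_opp ((z - 1 - s) ^ (2 * k + 1) * _)%C); f_equal.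
  set (p := ((z - 1 - s) ^ _ * _)%C) in *.
  set (r := ((z - 1 + s) ^ _ * _)%C) in *.
  replace r with (r + p - p)%C by ring; rewrite <- E; ring. }
assert (P1 := Cmod_ge_0 (z - 1 + s)); assert (P2 := Cmod_ge_0 (1 + z - s)).
assert (P3 := Cmod_ge_0 (z - 1 - s)); assert (P4 := Cmod_ge_0 (1 + z + s)).
set (p := Cmod (z - 1 + s)) in *; set (p' := Cmod (z - 1 - s)) in *.
set (r := Cmod (1 + z - s)) in *; set (r' := Cmod (1 + z + s)) in *.
assert (sq : forall u v, 0 <= u <= v -> u ^ 2 <= v ^ 2)
  by (intros u v Huv; now apply pow_incr).
(* If both pairs of moduli are ordered alike, the products differ strictly, against [M]; if they are
   ordered oppositely, the sign in [S] is violated. *)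
destruct (Rle_dec p p') as [C1|C1]; destruct (Rle_dec r r') as [C2|C2].
- assert (p < p') by (destruct C1 as [C1|C1]; [assumption|rewrite C1 in S; nra]).
  assert (r < r') by (destruct C2 as [C2|C2]; [assumption|rewrite C2 in S; nra]).
  assert (L : p ^ (2 * k + 1) * r ^ (2 * l + 1)
            < p' ^ (2 * k + 1) * r' ^ (2 * l + 1))
    by (apply pow_mult_lt; lra || lia); lra.
- assert (p ^ 2 <= p' ^ 2) by (apply sq; lra).
  assert (r' ^ 2 <= r ^ 2) by (apply sq; lra); nra.
- assert (p' ^ 2 <= p ^ 2) by (apply sq; lra).
  assert (r ^ 2 <= r' ^ 2) by (apply sq; lra); nra.
- assert (L : p' ^ (2 * k + 1) * r' ^ (2 * l + 1)
            < p ^ (2 * k + 1) * r ^ (2 * l + 1))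
    by (apply pow_mult_lt; lra || lia); lra.
Qed.

(** * Values on the unit circle *)

Lemma polar_pow (x : R) (n : nat) : (polar 1 x ^ n)%C = polar 1 (INR n * x).
Proof.
unfold polar; induction n as [|n IH].
- rewrite Rmult_0_l, cos_0, sin_0; apply injective_projections; simpl; ring.
- rewrite Cpow_S, IH, S_INR.
  replace ((INR n + 1) * x) with (x + INR n * x) by ring.
  rewrite cos_plus, sin_plus; apply injective_projections; simpl; ring.
Qed.

Lemma exp_pow_INR (x : R) (n : nat) : exp x ^ n = exp (INR n * x).
Proof.
induction n as [|n IH]; [simpl; now rewrite Rmult_0_l, exp_0|].
rewrite <- tech_pow_Rmult, IH, S_INR, <- exp_plus; f_equal; ring.
Qed.

Lemma exp_asinh (x : R) : exp (asinh x) = sqrt (1 + x * x) + x.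
Proof.
unfold asinh; replace (x ^ 2 + 1) with (1 + x * x) by ring.
rewrite exp_ln; [ring|].
assert (H : Rabs x < sqrt (1 + x * x)).
{ rewrite <- sqrt_Rsqr_abs; apply sqrt_lt_1; unfold Rsqr; nra. }
generalize (Rle_abs (- x)); rewrite Rabs_Ropp; lra.
Qed.

Lemma exp_opp_asinh (x : R) : exp (- asinh x) = sqrt (1 + x * x) - x.
Proof.
assert (S : sqrt (1 + x * x) * sqrt (1 + x * x) = 1 + x * x)
  by (apply sqrt_sqrt; nra).
apply (Rmult_eq_reg_l (exp (asinh x))).
- rewrite <- exp_plus, Rplus_opp_r, exp_0, exp_asinh; nra.
- apply Rgt_not_eq, exp_pos.
Qed.

Lemma polar_asin (y : R) : -1 <= y <= 1 ->
  polar 1 (asin y) = (RtoC (sqrt (1 - y * y)) + Ci * RtoC y)%C.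
Proof.
intros Hy; unfold polar; rewrite cos_asin, sin_asin by assumption.
unfold Rsqr; apply injective_projections; simpl; ring.
Qed.

Lemma polar_opp_asin (y : R) : -1 <= y <= 1 ->
  polar 1 (- asin y) = (RtoC (sqrt (1 - y * y)) - Ci * RtoC y)%C.
Proof.
intros Hy; unfold polar; rewrite cos_neg, sin_neg, cos_asin, sin_asin by assumption.
unfold Rsqr; apply injective_projections; simpl; ring.
Qed.

(* [u] is the square root of [t] of the paper's convention. *)
Lemma conjugate_sum_nums (n m : nat) (t : R) : -1 <= t <= 1 ->
  exists u : C, (u * u = RtoC t)%C /\
  ((RtoC (sqrt (1 - t)) - Ci * u) ^ n * (RtoC (sqrt (1 + t)) - u) ^ m
   + (RtoC (sqrt (1 - t)) + Ci * u) ^ n * (RtoC (sqrt (1 + t)) + u) ^ m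
   = 2 * (num2 n m t, num1 n m t))%C.
Proof.
intros Ht; unfold num1, num2; destruct (Rle_dec 0 t) as [T|T].
(* Here the two summands are [exp (-w)] and [exp w] with [w = m asinh √t + i n asin √t], and
   [cosh w = num2 + i num1]. *)
- assert (S : sqrt t * sqrt t = t) by now apply sqrt_sqrt.
  assert (B : -1 <= sqrt t <= 1).
  { assert (P := sqrt_pos t); split; [lra|nra]. }
  exists (RtoC (sqrt t)); split; [rewrite <- RtoC_mult; now f_equal|].
  assert (A1 := polar_asin _ B); assert (A2 := polar_opp_asin _ B).
  assert (E1 := exp_asinh (sqrt t)); assert (E2 := exp_opp_asinh (sqrt t)).
  rewrite S in A1, A2, E1, E2.
  rewrite <- A1, <- A2, <- RtoC_plus, <- RtoC_minus, <- E1, <- E2.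
  rewrite <- !RtoC_pow, !exp_pow_INR, !polar_pow.
  unfold polar, cosh, sinh; rewrite !Ropp_mult_distr_r_reverse, cos_neg, sin_neg.
  apply injective_projections; simpl; field.
- assert (T' : 0 <= - t) by lra.
  assert (S : sqrt (- t) * sqrt (- t) = - t) by now apply sqrt_sqrt.
  assert (B : -1 <= sqrt (- t) <= 1).
  { assert (P := sqrt_pos (- t)); split; [lra|nra]. }
  exists (Ci * RtoC (sqrt (- t)))%C; split.
  { replace (RtoC t) with (RtoC (- (sqrt (- t) * sqrt (- t))))
      by (f_equal; lra).
    apply injective_projections; simpl; ring. }
  assert (A1 := polar_asin _ B); assert (A2 := polar_opp_asin _ B).
  assert (E1 := exp_asinh (sqrt (- t))).
  assert (E2 := exp_opp_asinh (sqrt (- t))).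
  rewrite S in A1, A2, E1, E2.
  replace (1 - - t) with (1 + t) in A1, A2 by ring.
  change (1 + - t) with (1 - t) in E1, E2.
  rewrite <- A1, <- A2.
  (* For negative [t] the product [i u] is real, so the circular and the hyperbolic factors exchange
     roles. *)
  replace (sqrt (1 - t) - Ci * (Ci * sqrt (- t)))%C
    with (RtoC (exp (asinh (sqrt (- t)))))
    by (rewrite E1; apply injective_projections; simpl; ring).
  replace (sqrt (1 - t) + Ci * (Ci * sqrt (- t)))%C
    with (RtoC (exp (- asinh (sqrt (- t)))))
    by (rewrite E2; apply injective_projections; simpl; ring).
  rewrite <- !RtoC_pow, !exp_pow_INR, !polar_pow.
  unfold polar, cosh, sinh; rewrite !Ropp_mult_distr_r_reverse, cos_neg, sin_neg.
  apply injective_projections; simpl; field.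
Qed.

Lemma sqrt_1_minus_cos (theta : R) : 0 <= theta <= 2 * PI ->
  sqrt (1 - cos theta) = sqrt 2 * sin (theta / 2).
Proof.
intros Ht.
assert (P : 0 <= sin (theta / 2)) by (apply sin_ge_0; lra).
replace theta with (2 * (theta / 2)) at 1 by field.
rewrite cos_2a_sin.
replace (1 - _) with (2 * (sin (theta / 2) * sin (theta / 2))) by ring.
rewrite sqrt_mult by nra; now rewrite sqrt_square.
Qed.

Lemma sqrt_1_plus_cos (theta : R) : - PI <= theta <= PI ->
  sqrt (1 + cos theta) = sqrt 2 * cos (theta / 2).
Proof.
intros Ht.
assert (P : 0 <= cos (theta / 2)) by (apply cos_ge_0; lra).
replace theta with (2 * (theta / 2)) at 1 by field.
rewrite cos_2a_cos.
replace (1 + _) with (2 * (cos (theta / 2) * cos (theta / 2))) by ring.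
rewrite sqrt_mult by nra; now rewrite sqrt_square.
Qed.

(** Half-angle formulas. Let [ζ = exp (iθ)] and let [z = √2 exp (iθ/2)], as in the proof. Then
    [ζ - 1 = i z √(1 - t)], [1 + ζ = z √(1 + t)], and [s = z u] is a root of [1 + ζ^2 = 2 ζ t].
    Pulling [i z] and [z] out of the factors leaves the sum of [conjugate_sum_nums]. *)
Lemma rational_part_circle (k l : nat) (a : C -> C) (theta : R) :
  is_rational_part k l a -> 0 <= theta <= PI ->
  (a (polar 1 theta)
   = 2 * Ci * polar 1 theta * monomial_part k l (polar 1 theta)
     * (num2 (2 * k + 1) (2 * l + 1) (cos theta),
        num1 (2 * k + 1) (2 * l + 1) (cos theta)))%C.
Proof.
intros Ha Ht.
destruct (conjugate_sum_nums (2 * k + 1) (2 * l + 1) (cos theta)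
  (COS_bound theta)) as [u [U E]].
rewrite sqrt_1_minus_cos, sqrt_1_plus_cos in E by lra.
set (z := polar (sqrt 2) (theta / 2)).
assert (S2 : sqrt 2 * sqrt 2 = 2) by (apply sqrt_sqrt; lra).
assert (C2 : cos theta = 1 - 2 * sin (theta / 2) * sin (theta / 2))
  by (rewrite <- cos_2a_sin; f_equal; field).
assert (C2' : cos theta = 2 * cos (theta / 2) * cos (theta / 2) - 1)
  by (rewrite <- cos_2a_cos; f_equal; field).
assert (N2 : sin theta = 2 * sin (theta / 2) * cos (theta / 2))
  by (rewrite <- sin_2a; f_equal; field).
assert (Z : (z * z = 2 * polar 1 theta)%C).
{ unfold z, polar; apply injective_projections; simpl.
  - transitivity ((sqrt 2 * sqrt 2) * (cos (theta / 2) * cos (theta / 2)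
      - sin (theta / 2) * sin (theta / 2))); [ring|rewrite S2; lra].
  - transitivity ((sqrt 2 * sqrt 2) * (2 * sin (theta / 2) * cos (theta / 2)));
      [ring|rewrite S2; lra]. }
assert (V : (polar 1 theta - 1 = Ci * z * RtoC (sqrt 2 * sin (theta / 2)))%C).
{ unfold z, polar; apply injective_projections; simpl.
  - transitivity (- ((sqrt 2 * sqrt 2) * (sin (theta / 2) * sin (theta / 2))));
      [rewrite S2; lra|ring].
  - transitivity ((sqrt 2 * sqrt 2) * (sin (theta / 2) * cos (theta / 2)));
      [rewrite S2; lra|ring]. }
assert (W : (1 + polar 1 theta = z * RtoC (sqrt 2 * cos (theta / 2)))%C).
{ unfold z, polar; apply injective_projections; simpl.
  - transitivity ((sqrt 2 * sqrt 2) * (cos (theta / 2) * cos (theta / 2)));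
      [rewrite S2; lra|ring].
  - transitivity ((sqrt 2 * sqrt 2) * (sin (theta / 2) * cos (theta / 2)));
      [rewrite S2; lra|ring]. }
assert (Q : ((z * u) * (z * u) = 1 + polar 1 theta * polar 1 theta)%C).
{ transitivity ((z * z) * (u * u))%C; [ring|].
  rewrite Z, U; assert (T := sin2_cos2 theta); unfold Rsqr in T.
  unfold polar; apply injective_projections; simpl; [nra|ring]. }
assert (CC : (Ci * Ci = -1)%C)
  by (apply injective_projections; simpl; ring).
assert (F := Ha _ _ Q).
set (v := RtoC (sqrt 2 * sin (theta / 2))) in *.
set (w := RtoC (sqrt 2 * cos (theta / 2))) in *.
rewrite V, W in F.
replace (Ci * z * v + z * u)%C with (Ci * z * (v - Ci * u))%C in F
  by (transitivity (Ci * z * v - (Ci * Ci) * z * u)%C; [ring|rewrite CC; ring]).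
replace (Ci * z * v - z * u)%C with (Ci * z * (v + Ci * u))%C in F
  by (transitivity (Ci * z * v + (Ci * Ci) * z * u)%C; [ring|rewrite CC; ring]).
replace (z * w - z * u)%C with (z * (w - u))%C in F by ring.
replace (z * w + z * u)%C with (z * (w + u))%C in F by ring.
rewrite !Cpow_mult_l in F.
assert (G : ((Ci ^ (2 * k + 1) * z ^ (2 * k + 1)) * z ^ (2 * l + 1)
   = 2 * Ci * polar 1 theta * monomial_part k l (polar 1 theta))%C).
{ unfold monomial_part.
  rewrite !Cpow_add_r, !Cpow_mult_r, !Cpow_1_r.
  replace (z ^ 2)%C with (z * z)%C by ring.
  replace (Ci ^ 2)%C with (Ci * Ci)%C by ring.
  rewrite Z, CC.
  replace (-2 * polar 1 theta)%C with (-1 * (2 * polar 1 theta))%C by ring.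
  rewrite (Cpow_mult_l (-1)).
  transitivity ((-1) ^ k * (2 * polar 1 theta) ^ k * (2 * polar 1 theta) ^ l
    * Ci * (z * z))%C; [ring|rewrite Z; ring]. }
rewrite <- G.
assert (H : (2 * a (polar 1 theta) =
  2 * ((Ci ^ (2 * k + 1) * z ^ (2 * k + 1)) * z ^ (2 * l + 1)
  * (num2 (2 * k + 1) (2 * l + 1) (cos theta),
     num1 (2 * k + 1) (2 * l + 1) (cos theta))))%C).
{ rewrite F.
  transitivity ((Ci ^ (2 * k + 1) * z ^ (2 * k + 1)) * z ^ (2 * l + 1) *
    ((v - Ci * u) ^ (2 * k + 1) * (w - u) ^ (2 * l + 1)
     + (v + Ci * u) ^ (2 * k + 1) * (w + u) ^ (2 * l + 1)))%C; [ring|].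
  rewrite E; ring. }
apply (f_equal (fun c => (/ 2) * c)%C) in H.
rewrite !Cmult_assoc, Cinv_l, !Cmult_1_l in H; [exact H|].
intros K; apply RtoC_inj in K; lra.
Qed.

(** * The denominator: sum of squares and positivity *)

Lemma cosh_gt_1 (x : R) : x <> 0 -> 1 < cosh x.
Proof.
intros Hx; unfold cosh.
assert (H1 := exp_ineq1 x Hx); assert (H2 := exp_ineq1 (- x)).
assert (- x <> 0) by lra; specialize (H2 H); lra.
Qed.

Lemma asinh_pos (x : R) : 0 < x -> 0 < asinh x.
Proof.
intros Hx; apply exp_lt_inv; rewrite exp_0, exp_asinh.
assert (1 < sqrt (1 + x * x)); [|lra].
rewrite <- sqrt_1 at 1; apply sqrt_lt_1; nra.
Qed.

(** Both sides are [2 |cosh (y + ix)|^2], since [cosh (y + ix) = cos x cosh y + i sin x sinh y]. *)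
Lemma cos_plus_cosh_double (x y : R) :
  cos (2 * x) + cosh (2 * y)
  = 2 * ((sin x * sinh y) ^ 2 + (cos x * cosh y) ^ 2).
Proof.
assert (T := sin2_cos2 x); unfold Rsqr in T.
assert (X : exp y * exp (- y) = 1)
  by (rewrite <- exp_plus, Rplus_opp_r; apply exp_0).
rewrite cos_2a; unfold cosh, sinh.
replace (- (2 * y)) with (- y + - y) by ring.
replace (2 * y) with (y + y) by ring.
rewrite !exp_plus.
set (p := exp y) in *; set (q := exp (- y)) in *.
set (s := sin x) in *; set (c := cos x) in *.
(* Inserting [c^2 + s^2 = 1] and [p q = 1] makes the identity homogeneous, hence purely
   algebraic. *)
transitivity ((c * c + s * s) * ((p * p + q * q) / 2)
  + (c * c - s * s) * (p * q)); [rewrite X|field].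
replace (c * c + s * s) with 1 by lra; ring.
Qed.

Lemma den_sum_sqr (n m : nat) (t : R) :
  den n m t = 2 * (num1 n m t ^ 2 + num2 n m t ^ 2).
Proof.
unfold den, num1, num2; destruct (Rle_dec 0 t) as [T|T].
- rewrite !(Rmult_assoc 2); apply cos_plus_cosh_double.
- rewrite !(Rmult_assoc 2), Rplus_comm, cos_plus_cosh_double; ring.
Qed.

(** For [t <> 0] the hyperbolic cosine exceeds 1 and outweighs the cosine; at [t = 0] the cosine
    itself is 1. *)
Lemma den_pos (n m : nat) (t : R) : (0 < n)%nat -> (0 < m)%nat -> 0 < den n m t.
Proof.
intros Hn Hm; apply lt_INR in Hn, Hm; simpl in Hn, Hm; unfold den.
assert (P : forall a b : R, b <> 0 -> 0 < cos a + cosh b).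
{ intros a b Hb; assert (A := COS_bound a); assert (B := cosh_gt_1 b Hb); lra. }
destruct (Rle_dec 0 t) as [T|T].
- destruct T as [T| <-].
  + apply P, Rgt_not_eq, Rmult_lt_0_compat; [lra|].
    now apply asinh_pos, sqrt_lt_R0.
  + rewrite sqrt_0, asin_0, Rmult_0_r, cos_0; unfold cosh.
    assert (H := exp_pos (2 * INR m * asinh 0)).
    assert (H' := exp_pos (- (2 * INR m * asinh 0))); lra.
- rewrite Rplus_comm; apply P, Rgt_not_eq, Rmult_lt_0_compat; [lra|].
  apply asinh_pos, sqrt_lt_R0; lra.
Qed.

Lemma polar_1_neq_0 (theta : R) : polar 1 theta <> 0.
Proof. apply Cmod_gt_0; rewrite Cmod_polar, Rabs_R1; lra. Qed.

Lemma monomial_part_neq_0 (k l : nat) (z : C) :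
  z <> 0 -> monomial_part k l z <> 0.
Proof.
intros Hz; apply Cmult_neq_0; apply Cpow_nz, Cmult_neq_0; trivial;
  intros H; apply RtoC_inj in H; lra.
Qed.

Lemma nums_neq_0 (n m : nat) (t : R) : (0 < n)%nat -> (0 < m)%nat ->
  (num2 n m t, num1 n m t) <> RtoC 0.
Proof.
intros Hn Hm H; assert (P := den_pos n m t Hn Hm).
rewrite den_sum_sqr in P; injection H as H1 H2; rewrite H1, H2 in P; lra.
Qed.

Lemma rational_part_circle_neq_0 (k l : nat) (a : C -> C) (theta : R) :
  is_rational_part k l a -> 0 <= theta <= PI -> a (polar 1 theta) <> 0.
Proof.
intros Ha Ht; rewrite (rational_part_circle k l) by assumption.
apply Cmult_neq_0; [apply Cmult_neq_0; [apply Cmult_neq_0;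
  [apply Cmult_neq_0|]|]|].
- intros H; apply RtoC_inj in H; lra.
- intros H; injection H; lra.
- apply polar_1_neq_0.
- apply monomial_part_neq_0, polar_1_neq_0.
- apply nums_neq_0; lia.
Qed.

(** The quotient is [1 / (2i (num2 + i num1))], and [den] is twice the squared modulus of
    [num2 + i num1]. *)
Lemma circle_ratio (k l : nat) (a : C -> C) (theta : R) :
  is_rational_part k l a -> 0 <= theta <= PI ->
  let n := (2 * k + 1)%nat in let m := (2 * l + 1)%nat in
  let t := cos theta in
  (polar 1 theta * monomial_part k l (polar 1 theta) / a (polar 1 theta))%C
   = (- (num1 n m t / den n m t), - (num2 n m t / den n m t)).
Proof.
intros Ha Ht n m t; rewrite (rational_part_circle k l a theta Ha Ht).
fold n m t.
assert (P : 0 < den n m t) by (apply den_pos; unfold n, m; lia).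
assert (N := nums_neq_0 n m t); assert (D := den_sum_sqr n m t).
assert (Z := polar_1_neq_0 theta).
assert (M := monomial_part_neq_0 k l _ Z).
set (z := polar 1 theta) in *; set (w := monomial_part k l z) in *.
transitivity (/ (2 * Ci * (num2 n m t, num1 n m t)))%C.
{ field; repeat split; trivial.
  - apply N; unfold n, m; lia.
  - intros H; injection H; lra. }
rewrite D in P |- *.
apply injective_projections; simpl; field; nra.
Qed.


(** * Quotients of real entire functions on the half circle *)

Lemma circle_ratio_continuous (a A : C -> C) (theta : R) :
  real_entire a -> real_entire A -> a (polar 1 theta) <> 0 ->
  surface_continuous (fun r t => A (polar r t) / a (polar r t))%C 1 theta.
Proof.
intros [[a' Ha] _] [[A' HA] _] Z.
apply (complex_continuous_mult A (fun z => / a z)%C (polar 1 theta));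
  [apply HA| |reflexivity|apply surface_continuous_polar].
apply complex_continuous_inv; [exact Z|apply Ha].
Qed.

Lemma half_circle_ratio_integral (a A : C -> C) :
  real_entire a -> real_entire A ->
  (forall z, Cmod z < 1 -> a z <> 0) ->
  (forall theta, 0 <= theta <= PI -> a (polar 1 theta) <> 0) ->
  RInt (fun t => Re (A (polar 1 t) / a (polar 1 t))%C) 0 PI
  = PI * Re (A 0 / a 0)%C.
Proof.
intros [[a' Ha] Ra] [[A' HA] RA] Z1 Z2.
eapply (half_mean_value (fun z => A z / a z)%C).
- intros z Hz; apply holomorphic_mult; [apply HA|].
  apply holomorphic_inv; [now apply Z1|apply Ha].
- intros t Ht; apply complex_continuous_mult; [apply HA|].
  apply complex_continuous_inv; [now apply Z2|apply Ha].
- intros x; unfold Cdiv, Cinv, Cmult; simpl.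
  unfold Im in *; rewrite Ra, RA; unfold Rdiv; ring.
Qed.

(** * The substitution t = cos θ *)

(** Beyond 1 this is the default value of [acos]; it makes two-sided continuity at 1 possible. *)
Lemma acos_ge_1 (x : R) : 1 <= x -> acos x = 0.
Proof.
intros Hx; unfold acos, asin.
destruct (Rle_dec x (-1)); [lra|]; destruct (Rle_dec 1 x); [ring|lra].
Qed.

Lemma is_derive_acos (x : R) : -1 < x < 1 ->
  is_derive acos x (- / sqrt (1 - x ^ 2)).
Proof.
intros Hx.
replace (- / sqrt (1 - x ^ 2)) with (derive_pt acos x (derivable_pt_acos x Hx)).
- apply is_derive_Reals; unfold derive_pt; apply proj2_sig.
- rewrite derive_pt_acos; unfold Rsqr, Rdiv; simpl; rewrite Rmult_1_r; ring.
Qed.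

Lemma continuous_acos_1 : continuous acos 1.
Proof.
apply continuity_pt_filterlim; intros e He.
(* Capped at [PI] so that [cos] is decreasing on [[0, d]]; then [cos d < x] forces [acos x < d]. *)
set (d := Rmin (e / 2) PI).
assert (Hd : 0 < d <= PI /\ d < e).
{ assert (P := PI_RGT_0); split; [split|].
  - apply Rmin_pos; lra.
  - apply Rmin_r.
  - apply Rle_lt_trans with (e / 2); [apply Rmin_l|lra]. }
assert (C1 : cos d < 1) by (rewrite <- cos_0; apply cos_decreasing_1; lra).
exists (1 - cos d); split; [lra|].
intros x [_ Hx]; simpl in *; unfold Rdist in *; rewrite acos_1, Rminus_0_r.
destruct (Rle_dec 1 x) as [X|X]; [rewrite acos_ge_1, Rabs_R0; lra|].
apply Rabs_def2 in Hx; assert (B := COS_bound d); assert (A := acos_bound x).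
rewrite Rabs_pos_eq by lra.
apply Rlt_trans with d; [|lra].
apply cos_decreasing_0; try lra.
rewrite cos_acos; lra.
Qed.

Lemma continuous_acos (x : R) : -1 <= x <= 1 -> continuous acos x.
Proof.
intros Hx.
destruct (Req_dec x 1) as [->|N1]; [apply continuous_acos_1|].
destruct (Req_dec x (-1)) as [->|N2].
- apply (continuous_ext (fun y => PI + - acos (- y))).
  + intros y; change (PI + - acos (- y) = acos y); rewrite acos_opp; ring.
  + apply (continuous_plus (V := R_NormedModule) (fun _ => PI)
      (fun y => - acos (- y))); [apply continuous_const|].
    apply (continuous_opp (V := R_NormedModule) (fun y => acos (- y))).
    apply (continuous_comp Ropp acos).
    * apply (continuous_opp (V := R_NormedModule) (fun y => y)), continuous_id.
    * replace (- -1) with 1 by ring; apply continuous_acos_1.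
- apply (ex_derive_continuous (V := R_NormedModule)).
  eexists; apply is_derive_acos; lra.
Qed.

(** The interval is split at [c], and each half compares interior points only. The exceptional point
    will be [t = 0], where [/ t] has no meaning. *)
Lemma is_RInt_ext_except (f g : R -> R) (a b c l : R) :
  (forall x, Rmin a b < x < Rmax a b -> x <> c -> f x = g x) ->
  is_RInt f a b l -> is_RInt g a b l.
Proof.
assert (main : forall a b l, a <= b ->
  (forall x, a < x < b -> x <> c -> f x = g x) ->
  is_RInt f a b l -> is_RInt g a b l).
{ clear a b l; intros a b l Hab Hfg Hf.
  destruct (Rlt_dec a c) as [Hac|Hac]; [destruct (Rlt_dec c b) as [Hcb|Hcb]|].
  - assert (Ef : ex_RInt f a b) by (eexists; exact Hf).
    destruct (ex_RInt_Chasles_1 (V := R_CompleteNormedModule) f a c b)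
      as [l1 H1]; [lra|exact Ef|].
    destruct (ex_RInt_Chasles_2 (V := R_CompleteNormedModule) f a c b)
      as [l2 H2]; [lra|exact Ef|].
    assert (El : l = plus l1 l2).
    { transitivity (RInt f a b); [symmetry|];
        apply (is_RInt_unique (V := R_CompleteNormedModule)); [exact Hf|].
      exact (is_RInt_Chasles _ _ _ _ _ _ H1 H2). }
    rewrite El; apply (is_RInt_Chasles (V := R_NormedModule) g a c b);
      [apply (is_RInt_ext f); [|exact H1]|apply (is_RInt_ext f); [|exact H2]];
      intros x Hx; rewrite Rmin_left, Rmax_right in Hx by lra;
      apply Hfg; lra.
  - apply (is_RInt_ext f); [|exact Hf].
    intros x Hx; rewrite Rmin_left, Rmax_right in Hx by lra; apply Hfg; lra.
  - apply (is_RInt_ext f); [|exact Hf].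
    intros x Hx; rewrite Rmin_left, Rmax_right in Hx by lra; apply Hfg; lra. }
intros Hfg Hf; destruct (Rle_dec a b) as [Hab|Hab].
- apply main; trivial.
  rewrite Rmin_left, Rmax_right in Hfg by lra; exact Hfg.
- apply is_RInt_swap in Hf; apply main in Hf; [|lra|].
  + apply is_RInt_swap in Hf; rewrite opp_opp in Hf; exact Hf.
  + rewrite Rmin_right, Rmax_left in Hfg by lra; exact Hfg.
Qed.

Lemma is_RInt_gen_ext_except (f g : R -> R) (Fa Fb : (R -> Prop) -> Prop)
    (a b c l : R) :
  Filter Fa -> Filter Fb ->
  Fa (fun x => a < x < b) -> Fb (fun x => a < x < b) ->
  (forall x, a < x < b -> x <> c -> f x = g x) ->
  is_RInt_gen f Fa Fb l -> is_RInt_gen g Fa Fb l.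
Proof.
intros FFa FFb Ha Hb Hfg Hf P HP.
assert (HH : filter_prod Fa Fb (fun xy =>
  (a < fst xy < b /\ a < snd xy < b) /\
  exists v, is_RInt f (fst xy) (snd xy) v /\ P v)).
{ apply filter_and; [|exact (Hf P HP)].
  apply (Filter_prod _ _ _ _ _ Ha Hb); intros x y Hx Hy; now split. }
unfold filtermapi; revert HH; apply filter_imp.
intros [x y] [[Hx Hy] [v [Hv Pv]]].
simpl in *; exists v; split; [|exact Pv].
apply (is_RInt_ext_except f g x y c); [|exact Hv].
intros t Ht; apply Hfg.
unfold Rmin, Rmax in Ht; destruct (Rle_dec x y); lra.
Qed.

(** Minus the integral of [k] from 0 to [acos t] is an antiderivative of the integrand on the open
    interval, and it is continuous up to both end points, so the improper integral is its increment
    from -1 to 1. *)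
Lemma is_RInt_gen_acos (k g : R -> R) :
  (forall theta, 0 <= theta <= PI -> continuous k theta) ->
  (forall t, -1 < t < 1 -> t <> 0 -> g t = k (acos t) / sqrt (1 - t ^ 2)) ->
  is_RInt_gen g (at_right (-1)) (at_left 1) (RInt k 0 PI).
Proof.
intros Hk Hg.
assert (P := PI_RGT_0).
(* [acos] composed with [cos] folds the line onto [[0, PI]], which makes the
   integrand continuous everywhere. *)
set (K := fun theta => k (acos (cos theta))).
assert (KK : forall theta, 0 <= theta <= PI -> K theta = k theta)
  by (intros theta Ht; unfold K; now rewrite acos_cos).
assert (CK : forall theta, continuous K theta).
{ intros theta; apply (continuous_comp (fun t => acos (cos t)) k).
  - apply (continuous_comp cos acos).
    + apply continuous_cos.
    + apply continuous_acos, COS_bound.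
  - apply Hk, acos_bound. }
assert (DP : forall x, is_derive (RInt K 0) x (K x)).
{ intros x; apply is_derive_RInt with 0.
  - exists (mkposreal 1 Rlt_0_1); intros y _; apply RInt_correct.
    apply (ex_RInt_continuous (V := R_CompleteNormedModule)); intros; apply CK.
  - apply CK. }
set (G := fun t => - RInt K 0 (acos t)).
assert (CG : forall t, -1 <= t <= 1 -> continuous G t).
{ intros t Ht.
  apply (continuous_opp (V := R_NormedModule) (fun t => RInt K 0 (acos t))).
  apply (continuous_comp acos (RInt K 0)); [now apply continuous_acos|].
  apply (ex_derive_continuous (V := R_NormedModule)); eexists; apply DP. }
assert (sq : forall t, -1 < t < 1 -> 0 < sqrt (1 - t ^ 2))
  by (intros t Ht; apply sqrt_lt_R0; nra).
set (h := fun t => k (acos t) / sqrt (1 - t ^ 2)).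
assert (DG : forall t, -1 < t < 1 -> is_derive G t (h t)).
{ intros t Ht; eapply is_derive_eq.
  - apply (is_derive_opp (fun t => RInt K 0 (acos t))).
    exact (is_derive_comp (RInt K 0) acos t _ _ (DP _) (is_derive_acos t Ht)).
  - rewrite KK by apply acos_bound.
    unfold h, opp, scal; simpl; unfold mult; simpl.
    specialize (sq t Ht); simpl in sq; field; lra. }
assert (near : forall t, -1 < t < 1 -> locally t (fun u => -1 < u < 1)).
{ intros t Ht; apply filter_and; [now apply (open_gt (-1))|now apply (open_lt 1)]. }
assert (Ir : at_right (-1) (fun x => -1 < x < 1)).
{ assert (L : locally (-1) (fun x => x < 1)) by (apply (open_lt 1); lra).
  unfold at_right, within; revert L; apply filter_imp; intros; lra. }
assert (Il : at_left 1 (fun x => -1 < x < 1)).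
{ assert (L : locally 1 (fun x => -1 < x)) by (apply (open_gt (-1)); lra).
  unfold at_left, within; revert L; apply filter_imp; intros; lra. }
assert (inside : forall x y u, -1 < x < 1 -> -1 < y < 1 ->
  Rmin x y <= u <= Rmax x y -> -1 < u < 1).
{ intros x y u Hx Hy; unfold Rmin, Rmax; destruct (Rle_dec x y); lra. }
apply (is_RInt_gen_ext_except (Derive G) g _ _ (-1) 1 0);
  [apply at_right_proper_filter|apply at_left_proper_filter|assumption|assumption| |].
- intros t Ht Ht0; rewrite Hg by assumption.
  now apply is_derive_unique, DG.
- replace (RInt k 0 PI) with (G 1 - G (-1)).
  + apply is_RInt_gen_Derive.
    * apply (Filter_prod _ _ _ _ _ Ir Il); intros x y Hx Hy u Hu.
      eexists; apply DG; now apply (inside x y).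
    * apply (Filter_prod _ _ _ _ _ Ir Il); intros x y Hx Hy u Hu.
      assert (U := inside x y u Hx Hy Hu).
      apply (continuous_ext_loc _ h).
      { generalize (near u U); apply filter_imp; intros v Hv.
        symmetry; now apply is_derive_unique, DG. }
      apply (continuous_mult (fun t => k (acos t)) (fun t => / sqrt (1 - t ^ 2))).
      { apply (continuous_comp acos k); [apply continuous_acos; lra|].
        apply Hk, acos_bound. }
      apply (ex_derive_continuous (V := R_NormedModule)); auto_derive.
      assert (S := sq u U); simpl in S.
      split; [nra|split; [|trivial]].
      apply Rgt_not_eq; exact S.
    * eapply filterlim_filter_le_1; [|apply CG; lra].
      apply filter_le_within.
    * eapply filterlim_filter_le_1; [|apply CG; lra].
      apply filter_le_within.
  + unfold G; rewrite acos_1, RInt_point.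
    replace (acos (-1)) with PI
      by (replace (-1) with (- (1)) by ring; rewrite acos_opp, acos_1; ring).
    unfold zero; simpl.
    rewrite (RInt_ext K k); [ring|].
    intros x Hx; rewrite Rmin_left, Rmax_right in Hx by lra; apply KK; lra.
Qed.

Lemma is_RInt_acos (k g : R -> R) :
  (forall theta, 0 <= theta <= PI -> continuous k theta) ->
  (forall t, -1 < t < 1 -> g t = k (acos t)) ->
  is_RInt g (-1) 1 (RInt (fun theta => k theta * sin theta) 0 PI).
Proof.
intros Hk Hg.
assert (P := PI_RGT_0).
assert (CK : forall t, -1 <= t <= 1 -> continuous (fun t => k (acos t)) t).
{ intros t Ht; apply (continuous_comp acos k); [now apply continuous_acos|].
  apply Hk, acos_bound. }
apply (is_RInt_ext (fun t => k (acos t))).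
{ intros t Ht; rewrite Rmin_left, Rmax_right in Ht by lra; symmetry; now apply Hg. }
(* The substitution runs from [cos 0 = 1] down to [cos PI = -1]; the reversed orientation
   compensates the sign of [- sin y]. *)
assert (I : is_RInt (fun y => scal (- sin y) (k (acos (cos y)))) 0 PI
  (RInt (fun t => k (acos t)) (cos 0) (cos PI))).
{ apply (is_RInt_comp (fun t => k (acos t)) cos (fun y => - sin y)).
  - intros x _; apply CK, COS_bound.
  - intros x _; split; [apply is_derive_cos|].
    apply (continuous_opp (V := R_NormedModule) sin), continuous_sin. }
apply (is_RInt_unique (V := R_CompleteNormedModule)) in I.
rewrite cos_0, cos_PI in I.
assert (E : ex_RInt (fun t => k (acos t)) (-1) 1).
{ apply (ex_RInt_continuous (V := R_CompleteNormedModule)); intros t Ht.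
  rewrite Rmin_left, Rmax_right in Ht by lra; now apply CK. }
replace (RInt _ 0 PI) with (RInt (fun t => k (acos t)) (-1) 1);
  [exact (RInt_correct (V := R_CompleteNormedModule) _ _ _ E)|].
rewrite <- (opp_RInt_swap (V := R_CompleteNormedModule) _ _ _ E) in I.
rewrite <- (Ropp_involutive (RInt (fun t => k (acos t)) (-1) 1)).
transitivity (- RInt (fun y => scal (- sin y) (k (acos (cos y)))) 0 PI);
  [now rewrite I|].
rewrite <- (RInt_opp (V := R_CompleteNormedModule)).
- apply RInt_ext; intros t Ht; rewrite Rmin_left, Rmax_right in Ht by lra.
  rewrite acos_cos by lra; unfold opp, scal; simpl; unfold mult; simpl; ring.
- apply (ex_RInt_continuous (V := R_CompleteNormedModule)); intros t _.
  apply (continuous_mult (fun y => - sin y) (fun y => k (acos (cos y)))).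
  + apply (continuous_opp (V := R_NormedModule) sin), continuous_sin.
  + apply (continuous_comp cos (fun t => k (acos t)));
      [apply continuous_cos|apply CK, COS_bound].
Qed.

(** * Numerators *)

Lemma circle_ratio_Re_continuous (a A : C -> C) (theta : R) :
  real_entire a -> real_entire A -> a (polar 1 theta) <> 0 ->
  continuous (fun t => Re (A (polar 1 t) / a (polar 1 t))%C) theta.
Proof.
intros Ha HA Z.
apply (continuity_2d_pt_angle (fun r t => Re (A (polar r t) / a (polar r t))%C)).
now apply circle_ratio_continuous.
Qed.

Lemma circle_ratio_Im_continuous (a A : C -> C) (theta : R) :
  real_entire a -> real_entire A -> a (polar 1 theta) <> 0 ->
  continuous (fun t => Im (A (polar 1 t) / a (polar 1 t))%C) theta.
Proof.
intros Ha HA Z.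
apply (continuity_2d_pt_angle (fun r t => Im (A (polar r t) / a (polar r t))%C)).
now apply circle_ratio_continuous.
Qed.

Lemma polar_1_plus_sqr (theta : R) :
  (1 + polar 1 theta * polar 1 theta
   = 2 * polar 1 theta * RtoC (cos theta))%C.
Proof.
assert (T := sin2_cos2 theta); unfold Rsqr in T.
unfold polar; apply injective_projections; simpl; [nra|ring].
Qed.

Lemma polar_1_sqr_minus (theta : R) :
  (polar 1 theta * polar 1 theta - 1
   = 2 * polar 1 theta * (Ci * RtoC (sin theta)))%C.
Proof.
assert (T := sin2_cos2 theta); unfold Rsqr in T.
unfold polar; apply injective_projections; simpl; [nra|ring].
Qed.

(* Makes [moment_coef * z^(k+l-j) * (1+z^2)^j] equal to
   [- M(z) ((z + 1/z)/2)^j]. *)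
Definition moment_coef (k l j : nat) : R := - ((-2) ^ k * 2 ^ l / 2 ^ j).

(** Since [1 + z^2 = 2 z t] on the circle, the powers of [z] add up to [p + j = k + l], the degree
    of [M]. *)
Lemma moment_numerator_circle (k l j p : nat) (theta : R) :
  (p + j = k + l)%nat ->
  (RtoC (moment_coef k l j) * (polar 1 theta ^ p
     * (1 + polar 1 theta * polar 1 theta) ^ j)
   = - (monomial_part k l (polar 1 theta) * RtoC (cos theta ^ j)))%C.
Proof.
intros E; rewrite polar_1_plus_sqr; set (z := polar 1 theta).
unfold monomial_part; rewrite !Cpow_mult_l, <- !RtoC_pow.
transitivity (RtoC (moment_coef k l j * 2 ^ j) * z ^ (p + j)
  * RtoC (cos theta ^ j))%C; [rewrite Cpow_add_r, RtoC_mult; ring|].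
rewrite E, Cpow_add_r; unfold moment_coef.
replace (- ((-2) ^ k * 2 ^ l / 2 ^ j) * 2 ^ j) with (- ((-2) ^ k * 2 ^ l))
  by (field; apply pow_nonzero; lra).
rewrite RtoC_opp, RtoC_mult; ring.
Qed.

Lemma real_entire_moment_numerator (c : R) (p j : nat) :
  real_entire (fun z => RtoC c * (z ^ p * (1 + z * z) ^ j))%C.
Proof. real_entire. Qed.

(** * The choice of numerator for each of the three integrals *)

Theorem theorem1 (n m : nat) (hn : Nat.Odd n) (hm : Nat.Odd m) :
  (* j = -1 : improper integral over (-1,1) equals pi/2 *)
  is_RInt_gen (fun t => num1 n m t / den n m t * (/ t) / sqrt (1 - t ^ 2))
    (at_right (-1)) (at_left 1) (PI / 2)
  /\
  (* j = 0, 1, ..., (m+n-2)/2 *)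
  (forall j : nat, (2 * j + 2 <= m + n)%nat ->
     is_RInt_gen (fun t => num1 n m t / den n m t * t ^ j / sqrt (1 - t ^ 2))
       (at_right (-1)) (at_left 1) 0)
  /\
  (* second family: j = 0, 1, ..., (m+n-4)/2 *)
  (forall j : nat, (2 * j + 4 <= m + n)%nat ->
     is_RInt (fun t => num2 n m t / den n m t * t ^ j) (-1) 1 0).
Proof.
destruct hn as [k ->], hm as [l ->].
destruct (rational_part_exists k l) as [a [b [q [Ra [Rb [Rq [E Q]]]]]]].
assert (Ha := rational_part_conjugate_sum k l a b E).
assert (Z1 : forall z, Cmod z < 1 -> a z <> 0)
  by (intros z Hz; now apply (rational_part_neq_0 k l)).
assert (Z2 : forall t, 0 <= t <= PI -> a (polar 1 t) <> 0)
  by (intros t Ht; now apply (rational_part_circle_neq_0 k l)).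
assert (ratio := circle_ratio k l a).
set (n := (2 * k + 1)%nat) in *; set (m := (2 * l + 1)%nat) in *.
assert (P := PI_RGT_0).
split; [|split].
(* On the circle [num1 / (den t)] is the real part of [-2 z^2 M / ((1 + z^2) a)]. Adding the purely
   imaginary [-(1/2) (z^2 - 1) / (1 + z^2)] and using [Q] with [(z^2 - 1)^2 + 4 z^2 = (1 + z^2)^2]
   cancels [1 + z^2] and leaves [A / a]. *)
- set (A := fun z => (RtoC (- (1 / 2)) * ((z * z + RtoC (-1)) * q z
              + monomial_part k l z * (1 + z * z)))%C).
  assert (RM := real_entire_monomial_part k l).
  assert (RA : real_entire A) by (unfold A; real_entire).
  assert (V : forall t, 0 <= t <= PI -> cos t <> 0 ->
    Re (A (polar 1 t) / a (polar 1 t))%C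
    = num1 n m (cos t) / den n m (cos t) / cos t).
  { intros t Ht Hc.
    assert (S1 := polar_1_plus_sqr t); assert (S2 := polar_1_sqr_minus t).
    assert (Z3 := polar_1_neq_0 t); specialize (ratio t Ha Ht); specialize (Z2 t Ht).
    specialize (Q (polar 1 t)); simpl in ratio.
    set (z := polar 1 t) in *; set (w := monomial_part k l z) in *.
    assert (Hc' : RtoC (cos t) <> 0) by (intros H; apply Hc, RtoC_inj, H).
    assert (H2 : RtoC 2 <> 0) by (intros H; apply RtoC_inj in H; lra).
    (* That decomposition, cleared of the denominator [1 + z^2 = 2 z t]. *)
    assert (K : (2 * z * RtoC (cos t) * A z
      = RtoC (- (1 / 2)) * (2 * z * (Ci * RtoC (sin t)) * a z
          + 4 * (z * z) * w))%C).
    { rewrite <- S1, <- S2; unfold A; fold w; rewrite Q; ring. }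
    assert (K' : (A z / a z = RtoC (- (1 / 2)) * (Ci * RtoC (sin t / cos t))
      + RtoC (- / cos t) * (z * w / a z))%C).
    { rewrite (RtoC_opp (/ cos t)), (RtoC_inv (cos t)), (RtoC_div (sin t)) by exact Hc.
      rewrite (RtoC_opp (1 / 2)), (RtoC_div 1 2) in * by lra.
      transitivity ((2 * z * RtoC (cos t) * A z) / (2 * z * RtoC (cos t) * a z))%C;
        [|rewrite K]; field; repeat split; assumption. }
    rewrite K', ratio; simpl; field; split; [|exact Hc].
    apply Rgt_not_eq, den_pos; unfold n, m; lia. }
  replace (PI / 2)
    with (RInt (fun t => Re (A (polar 1 t) / a (polar 1 t))%C) 0 PI).
  + apply is_RInt_gen_acos.
    * intros t Ht; apply circle_ratio_Re_continuous; auto.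
    * intros t Ht Ht0; rewrite V; rewrite ?cos_acos by lra;
        [reflexivity|apply acos_bound|exact Ht0].
  + rewrite half_circle_ratio_integral by assumption.
    assert (N0 : a (RtoC 0) <> 0) by (apply Z1; rewrite Cmod_0; lra).
    (* At 0, [Q] reads [a 0 = q 0 - M(0)], while [A 0 = (q 0 - M(0)) / 2]; the quotient 1/2 yields
       [PI / 2]. *)
    assert (A0 : A (RtoC 0) = (RtoC (1 / 2) * a (RtoC 0))%C).
    { unfold A; rewrite Q, RtoC_opp; ring. }
    rewrite A0; replace (_ / _)%C with (RtoC (1 / 2)) by (field; exact N0).
    simpl; field.
- intros j Hj.
  (* On the circle [A = - z M t^j]. The bound on [j] means [j <= k + l], so the subtraction is
     exact, and the last factor [z] makes [A] vanish at 0. *)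
  set (A := fun z : C => (RtoC (moment_coef k l j)
              * (z ^ (k + l - j) * (1 + z * z) ^ j) * z)%C).
  assert (RA : real_entire A) by (unfold A; real_entire).
  assert (V : forall t, 0 <= t <= PI ->
    Re (A (polar 1 t) / a (polar 1 t))%C
    = num1 n m (cos t) / den n m (cos t) * cos t ^ j).
  { intros t Ht; unfold A.
    rewrite moment_numerator_circle by (unfold n, m in Hj; lia).
    specialize (ratio t Ha Ht); simpl in ratio.
    transitivity (Re (RtoC (- cos t ^ j) * (polar 1 t
      * monomial_part k l (polar 1 t) / a (polar 1 t)))%C).
    - f_equal; rewrite RtoC_opp; unfold Cdiv; ring.
    - rewrite ratio; simpl; ring. }
  replace 0 with (RInt (fun t => Re (A (polar 1 t) / a (polar 1 t))%C) 0 PI).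
  + apply is_RInt_gen_acos.
    * intros t Ht; apply circle_ratio_Re_continuous; auto.
    * intros t Ht Ht0; rewrite V; rewrite ?cos_acos by lra;
        [reflexivity|apply acos_bound].
  + rewrite half_circle_ratio_integral by assumption.
    unfold A; rewrite Cmult_0_r; unfold Cdiv; rewrite Cmult_0_l; simpl; ring.
- intros j Hj.
  destruct (Nat.le_exists_sub (S j) (k + l)) as [p [Ep _]];
    [unfold n, m in Hj; lia|].
  (* On the circle this is [M t^j] times [(z^2 - 1)/2 = i z sin θ], where [i] moves [num2] into the
     real part. Now [j + 1 <= k + l], so the exponent [S p] is positive and [A] vanishes at 0. *)
  set (A := fun z : C => (RtoC (1 / 2) * (RtoC (- moment_coef k l j)
     * (z ^ S p * (1 + z * z) ^ j) * (z * z + RtoC (-1))))%C).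
  assert (RA : real_entire A) by (unfold A; real_entire).
  assert (V : forall t, 0 <= t <= PI ->
    Re (A (polar 1 t) / a (polar 1 t))%C
    = num2 n m (cos t) / den n m (cos t) * cos t ^ j * sin t).
  { intros t Ht; unfold A.
    rewrite RtoC_opp.
    replace (- RtoC (moment_coef k l j) * _)%C
      with (monomial_part k l (polar 1 t) * RtoC (cos t ^ j))%C.
    2: { transitivity (- - (monomial_part k l (polar 1 t) * RtoC (cos t ^ j)))%C;
           [ring|].
         rewrite <- (moment_numerator_circle k l j (S p)) by lia; ring. }
    replace (polar 1 t * polar 1 t + RtoC (-1))%C
      with (2 * polar 1 t * (Ci * RtoC (sin t)))%C
      by (rewrite <- polar_1_sqr_minus; ring).
    specialize (ratio t Ha Ht); simpl in ratio.
    transitivity (Re (Ci * RtoC (sin t * cos t ^ j) * (polar 1 t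
      * monomial_part k l (polar 1 t) / a (polar 1 t)))%C).
    - f_equal; rewrite (RtoC_mult (sin t)), (RtoC_div 1 2) by lra.
      field; now apply Z2.
    - rewrite ratio; simpl; ring. }
  set (B := fun z : C => (z * monomial_part k l z)%C).
  assert (RB : real_entire B).
  { unfold B; assert (RM := real_entire_monomial_part k l); real_entire. }
  (* The integrand before the factor [sin θ] appears, expressed through [z M / a] because the
     continuity of that quotient on the half circle is known. *)
  set (w := fun t => - Im (B (polar 1 t) / a (polar 1 t))%C * cos t ^ j).
  assert (W : forall t, 0 <= t <= PI ->
    w t = num2 n m (cos t) / den n m (cos t) * cos t ^ j).
  { intros t Ht; unfold w, B; specialize (ratio t Ha Ht); simpl in ratio.
    rewrite ratio; simpl; ring. }
  replace 0 with (RInt (fun t => w t * sin t) 0 PI).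
  + apply is_RInt_acos.
    * intros t Ht.
      apply (continuous_mult (fun t => - Im (B (polar 1 t) / a (polar 1 t))%C)
        (fun t => cos t ^ j)).
      -- apply (continuous_opp (V := R_NormedModule)
           (fun t => Im (B (polar 1 t) / a (polar 1 t))%C)).
         apply circle_ratio_Im_continuous; auto.
      -- apply (ex_derive_continuous (V := R_NormedModule)).
         auto_derive; trivial.
    * intros t Ht; rewrite W by apply acos_bound.
      now rewrite cos_acos by lra.
  + rewrite (RInt_ext _ (fun t => Re (A (polar 1 t) / a (polar 1 t))%C)).
    * rewrite half_circle_ratio_integral by assumption.
      unfold A; rewrite Cpow_S, !Cmult_0_l, Cmult_0_r, Cmult_0_l, Cmult_0_r.
      unfold Cdiv; rewrite Cmult_0_l; simpl; ring.
    * intros t Ht; rewrite Rmin_left, Rmax_right in Ht by lra.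
      rewrite V, W by lra; reflexivity.
Qed.
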